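(* Let $X$ be a Banach space and $\{T(t)\}_{t\ge 0}$ a bounded $C_0$-semigroup on $X$. (1) The map $\eta^{\odot}:(L_T(X,X^{\odot\odot}),\kappa^{\odot\odot})\to(L_T(X^{\odot}),\kappa^{\odot})$, $V\mapsto V^*|_{X^{\odot}}$, i.e. $\langle x,\eta^{\odot}(V)x^{\odot}\rangle=\langle Vx,x^{\odot}\rangle$ for $x\in X$, $x^\odot\in X^\odot$, is continuous and is an algebra isomorphism in the order-reversing sense: it is a linear bijection with $\eta^{\odot}(V\circ U)=\eta^{\odot}(U)\eta^{\odot}(V)$ for all $U,V\in L_T(X,X^{\odot\odot})$. (2) $\eta^{\odot}(T(t))=T^{\odot}(t)$ for all $t\ge0$. (3) Let $\mathcal S_0^{\odot}:=\eta^{\odot}(\mathcal S_0)$, $\mathcal T_0^{\odot}:=\eta^{\odot}(\mathcal T_0)$, $\mathcal U_0^{\odot}:=\eta^{\odot}(\mathcal U_0)$. Then, with respect to the topology $\kappa^{\odot}$: (a) $\mathcal S^{\odot}\subset\mathcal S_0^{\odot}\subset\mathcal T_0^{\odot}\subset\mathcal U_0^{\odot}\subset L(X^{\odot})$; (b) $\mathcal S^{\odot}$ is dense in $\mathcal S_0^{\odot}$, and $\mathcal S_0^{\odot}$ is compact; (c) $\mathcal T^{\odot}$ is dense in $\mathcal T_0^{\odot}$, and $\mathcal T_0^{\odot}$ is convex and compact; (d) $\mathcal U^{\odot}$ is dense in $\mathcal U_0^{\odot}$, and $\mathcal U_0^{\odot}$ is absolutely convex and compact.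
   Context: Sun duals: $X^{\odot}=\{x^*\in X^*:\lim_{t\to0}\|T^*(t)x^*-x^*\|=0\}$ (norm-closed, weak*-dense, $T^*(t)$-invariant), $T^{\odot}(t)=T^*(t)|_{X^{\odot}}$, and $X^{\odot\odot}=\{\varphi\in X^{\odot *}:\lim_{t\to0}\|(T^{\odot}(t))^*\varphi-\varphi\|=0\}$. $X$ is regarded as a subset of $X^{\odot\odot}$ via $x\mapsto\langle x,\cdot\rangle|_{X^\odot}$. $L_T(X,X^{\odot\odot})=\{U\in L(X,X^{\odot\odot}):U^*(X^\odot)\subset X^\odot,\ U^{\odot*}(X^{\odot\odot})\subset X^{\odot\odot}\}$, where $U^*x^\odot\in X^*$ is $x\mapsto\langle Ux,x^\odot\rangle$, $U^\odot=U^*|_{X^\odot}$ and $U^{\odot*}=(U^\odot)^*$. Product on it: $(U\circ V)x=\{x^{\odot}\mapsto\langle Vx,U^{\odot}x^{\odot}\rangle\}$. $L_T(X^{\odot})=\{T\in L(X^{\odot}):T^*(X^{\odot\odot})\subset X^{\odot\odot}\}$, with composition. Topologies: $\kappa^{\odot\odot}$ on $L_T(X,X^{\odot\odot})$: $T_\lambda\to T$ iff $\langle T_\lambda x,x^\odot\rangle\to\langle Tx,x^\odot\rangle$ for all $x\in X,x^\odot\in X^\odot$; $\kappa^{\odot}$ on $L(X^\odot)$: $T_\lambda\to T$ iff $\langle T_\lambda x^\odot,x\rangle\to\langle Tx^\odot,x\rangle$ for all $x\in X,x^\odot\in X^\odot$. $\mathcal S=\{T(t):t\ge0\}$, $\mathcal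 T=\mathrm{co}(\mathcal S)$ (convex hull), $\mathcal U=\mathrm{ac}(\mathcal S)$ (absolutely convex hull); $\mathcal S^\odot=\{T^\odot(t):t\ge0\}$, $\mathcal T^\odot=\mathrm{co}(\mathcal S^\odot)$, $\mathcal U^\odot=\mathrm{ac}(\mathcal S^\odot)$. Compactifications: $\eta:L(X,X^{**})\to L(X^* )$, $\langle x,\eta(U)x^*\rangle=\langle Ux,x^*\rangle$; $w^*OT$ on $L(E,F^* )$ is pointwise weak* convergence, tested against $F$. For $\mathcal V\in\{\mathcal S,\mathcal T,\mathcal U\}$, $\mathcal V_0:=\eta^{-1}(\overline{\eta(\mathcal V)}^{\,w^*OT})\subset L(X,X^{**})$ (equivalently the $w^*OT$-closure of $\mathcal V$ in $L(X,X^{**})$). Regarding elements of $X^{**}$ as functionals on $X^\odot$ by restriction, one has $\mathcal V_0\subset L_T(X,X^{\odot\odot})$, and $\eta^\odot(\mathcal V_0)$ is understood in this sense. *)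

(* Defs.v *)
From HB Require Import structures.
From mathcomp Require Import all_boot all_order all_algebra.
From mathcomp Require Import complex.
From mathcomp Require Import all_classical all_reals all_analysis.

Set Implicit Arguments.
Unset Strict Implicit.
Unset Printing Implicit Defensive.

Import Order.TTheory GRing.Theory Num.Theory.
Import numFieldNormedType.Exports.

Local Open Scope classical_set_scope.
Local Open Scope ring_scope.

(* A Banach space is taken over R or over C; both cases are covered. *)
Variant scalar_kind := RealScalars | ComplexScalars.

Definition scalars (R : realType) (k : scalar_kind) : numFieldType :=
  match k with RealScalars => R | ComplexScalars => R[i] end.

(* Norms are scalar-valued, hence suprema of sets of nonnegative scalars; over
   R[i] a nonnegative scalar has zero imaginary part. *)
Definition scalar_sup (R : realType) (k : scalar_kind) :
    set (scalars R k) -> scalars R k :=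
  match k with
  | RealScalars => fun A : set R => sup A
  | ComplexScalars => fun A : set R[i] =>
      (sup [set complex.Re z | z in A])%:C%C : R[i]
  end.

Lemma scalar_supP (R : realType) (k : scalar_kind) (A : set (scalars R k))
    (M : scalars R k) :
    A !=set0 -> (forall a, A a -> 0 <= a) -> (forall a, A a -> a <= M) ->
  (forall a, A a -> a <= scalar_sup A) /\ scalar_sup A <= M.
Proof.
case: k A M => /= A M A0 Age0 AM.
  split; last exact: ge_sup.
  by move=> a Aa; apply: ub_le_sup => //; exists M.
have reA : [set complex.Re z | z in A] !=set0.
  by case: A0 => a Aa; exists (complex.Re a), a.
have ubA : ubound [set complex.Re z | z in A] (complex.Re M).
  by move=> _ [a /AM + <-]; rewrite lecE => /andP[].
split=> [a Aa|].
  have := Age0 a Aa; rewrite lecE/= => /andP[/eqP a0 _].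
  rewrite lecE/= a0 eqxx/=; apply: ub_le_sup; first by exists (complex.Re M).
  by exists a.
have imM : complex.Im M = 0.
  case: A0 => a Aa; have := Age0 a Aa; have := AM a Aa.
  by rewrite !lecE/= => /andP[/eqP -> _] /andP[/eqP -> _].
by rewrite lecE/= imM eqxx/=; exact: ge_sup.
Qed.

Section bounded_operators.
Context {R : realType} {k : scalar_kind}.
Local Notation K := (scalars R k).
Variables E F : normedModType K.

Definition is_bounded_op (f : E -> F) : Prop :=
  linear f /\ exists M : K, forall x, `|f x| <= M * `|x|.

Definition bounded_op_pred : {pred E -> F} := mem [set f | is_bounded_op f].

Lemma bounded_op_submod_closed : submod_closed bounded_op_pred.
Proof.
split.
  rewrite inE; split; first by move=> a x y; rewrite -[RHS]/(a *: 0 + 0) scaler0 addr0.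
  by exists 0 => x; rewrite mul0r -[leLHS]/(`|0 : F|) normr0.
move=> a f g; rewrite !inE => -[lf [Mf Hf]] [lg [Mg Hg]]; split.
  move=> b x y.
  rewrite -[LHS]/(a *: f (b *: x + y) + g (b *: x + y)).
  rewrite -[RHS]/(b *: (a *: f x + g x) + (a *: f y + g y)).
  by rewrite lf lg !scalerDr !scalerA [a * b]mulrC addrACA.
exists (`|a| * Mf + Mg) => x.
rewrite -[leLHS]/(`|a *: f x + g x|) (le_trans (ler_normD _ _))//.
by rewrite mulrDl lerD// normrZ -mulrA ler_wpM2l.
Qed.

HB.instance Definition _ := GRing.isSubmodClosed.Build K (E -> F)
  bounded_op_pred bounded_op_submod_closed.

Record bounded_op := BoundedOp {
  bounded_op_fun :> E -> F;
  bounded_opP : bounded_op_fun \in bounded_op_pred }.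

HB.instance Definition _ := [isSub for bounded_op_fun].
HB.instance Definition _ := [Choice of bounded_op by <:].
HB.instance Definition _ := [SubChoice_isSubLmodule of bounded_op by <:].

Definition mk_op (f : E -> F) (lf : linear f)
    (bf : exists M : K, forall x, `|f x| <= M * `|x|) : bounded_op :=
  BoundedOp (mem_set (conj lf bf)).

Lemma op_ext (A B : bounded_op) : (forall x, A x = B x) -> A = B.
Proof. by move=> AB; apply: val_inj; exact/funext. Qed.

Lemma op_linear (A : bounded_op) : linear A.
Proof. by case: A => f /= /[!inE] -[]. Qed.

Lemma op0 (A : bounded_op) : A 0 = 0.
Proof. by have := op_linear A (-1) 0 0; rewrite scaler0 addr0 scaleN1r addNr. Qed.

Lemma opD (A : bounded_op) x y : A (x + y) = A x + A y.
Proof. by have := op_linear A 1 x y; rewrite !scale1r. Qed.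

Lemma opZ (A : bounded_op) a x : A (a *: x) = a *: A x.
Proof. by have := op_linear A a x 0; rewrite op0 !addr0. Qed.

Lemma opB (A : bounded_op) x y : A (x - y) = A x - A y.
Proof. by rewrite -[- y]scaleN1r opD opZ scaleN1r. Qed.

Lemma op_bounded (A : bounded_op) :
  exists2 M : K, 0 <= M & forall x, `|A x| <= M * `|x|.
Proof.
case: A => f /= /[!inE] -[_ [M HM]].
have [[x x0]|H] := pselect (exists x : E, x != 0).
  exists M => //; have := le_trans (normr_ge0 _) (HM x).
  by rewrite pmulr_lge0// normr_gt0.
exists 0 => // x; have [->|x0] := eqVneq x 0; last by case: H; exists x.
by have := HM 0; rewrite normr0 !mulr0.
Qed.

Lemma zero_opE x : (0 : bounded_op) x = 0. Proof. by []. Qed.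
Lemma add_opE (A B : bounded_op) x : (A + B) x = A x + B x. Proof. by []. Qed.
Lemma opp_opE (A : bounded_op) x : (- A) x = - A x. Proof. by []. Qed.
Lemma scale_opE a (A : bounded_op) x : (a *: A) x = a *: A x.
Proof. by []. Qed.

Definition op_norm (A : bounded_op) : K :=
  scalar_sup [set `|A x| | x in [set x | `|x| <= 1]].

Let op_norm_sup (A : bounded_op) (M : K) :
    0 <= M -> (forall x, `|A x| <= M * `|x|) ->
  (forall x, `|x| <= 1 -> `|A x| <= op_norm A) /\ op_norm A <= M.
Proof.
move=> M0 HM.
have [] := @scalar_supP R k [set `|A x| | x in [set x | `|x| <= 1]] M.
- by exists `|A 0|, 0 => //=; rewrite normr0.
- by move=> _ [x _ <-].
- by move=> _ [x x1 <-]; rewrite (le_trans (HM _))// ler_piMr.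
by move=> H1 H2; split => // x x1; apply: H1; exists x.
Qed.

Lemma op_norm_le (A : bounded_op) (M : K) :
  0 <= M -> (forall x, `|A x| <= M * `|x|) -> op_norm A <= M.
Proof. by move=> M0 /(op_norm_sup M0)[]. Qed.

Lemma le_op_norm (A : bounded_op) x : `|A x| <= op_norm A * `|x|.
Proof.
have [M M0 HM] := op_bounded A; have [H _] := op_norm_sup M0 HM.
have [->|x0] := eqVneq x 0; first by rewrite op0 !normr0 mulr0.
have /H : `| `|x|^-1 *: x| <= 1.
  by rewrite normrZ normfV normr_id mulVf// normr_eq0.
rewrite opZ normrZ normfV normr_id mulrC ler_pdivrMr// normr_gt0//.
Qed.

Lemma op_norm_ge0 (A : bounded_op) : 0 <= op_norm A.
Proof.
have [M M0 HM] := op_bounded A; have [H _] := op_norm_sup M0 HM.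
by rewrite (le_trans _ (H 0 _))// normr0.
Qed.

Let op_normD A B : op_norm (A + B) <= op_norm A + op_norm B.
Proof.
apply: op_norm_le => [|x]; first by rewrite addr_ge0// op_norm_ge0.
by rewrite add_opE (le_trans (ler_normD _ _))// mulrDl lerD// le_op_norm.
Qed.

Let op_normZ_le a A : op_norm (a *: A) <= `|a| * op_norm A.
Proof.
apply: op_norm_le => [|x]; first by rewrite mulr_ge0// op_norm_ge0.
by rewrite scale_opE normrZ -mulrA ler_wpM2l// le_op_norm.
Qed.

Let op_normZ a A : op_norm (a *: A) = `|a| * op_norm A.
Proof.
apply/eqP; rewrite eq_le op_normZ_le/=.
have [->|a0] := eqVneq a 0; first by rewrite normr0 mul0r op_norm_ge0.
rewrite -ler_pdivlMl ?normr_gt0// -normfV.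
by rewrite -{1}[A]scale1r -(mulVf a0) -scalerA op_normZ_le.
Qed.

Let op_norm0_eq0 A : op_norm A = 0 -> A = 0.
Proof.
move=> A0; apply: op_ext => x; apply/eqP; rewrite zero_opE -normr_le0.
by rewrite (le_trans (le_op_norm _ _))// A0 mul0r.
Qed.

HB.instance Definition _ := @Lmodule_isNormed.Build K bounded_op
  op_norm op_normD op_normZ op_norm0_eq0.

Lemma op_normE (A : bounded_op) : `|A| = op_norm A. Proof. by []. Qed.

Lemma op_normM (A : bounded_op) x : `|A x| <= `|A| * `|x|.
Proof. exact: le_op_norm. Qed.

End bounded_operators.

Arguments bounded_op {R k} E F.

Section operator_constructions.
Context {R : realType} {k : scalar_kind}.
Local Notation K := (scalars R k).
Implicit Types E F G : normedModType K.

Definition dual E := bounded_op E K^o.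

Lemma id_bounded E : exists M : K, forall x : E, `|x| <= M * `|x|.
Proof. by exists 1 => x; rewrite mul1r. Qed.

Definition op_id E : bounded_op E E :=
  @mk_op R k E E (fun x => x) (fun _ _ _ => erefl) (id_bounded E).

Section composition.
Variables (E F G : normedModType K).
Variables (A : bounded_op F G) (B : bounded_op E F).

Lemma comp_linear : linear (fun x => A (B x)).
Proof. by move=> a x y; rewrite (op_linear B) (op_linear A). Qed.

Lemma comp_bounded : exists M : K, forall x, `|A (B x)| <= M * `|x|.
Proof.
exists (`|A| * `|B|) => x.
by rewrite (le_trans (op_normM A _))// -mulrA ler_wpM2l// op_normM.
Qed.

Definition op_comp : bounded_op E G := mk_op comp_linear comp_bounded.

End composition.

Section flip.
Variables (E F : normedModType K) (A : bounded_op E (dual F)).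

Lemma flip1_linear (y : F) : linear (fun x => A x y : K^o).
Proof. by move=> a x z; rewrite (op_linear A). Qed.

Lemma flip1_bounded (y : F) :
  exists M : K, forall x, `|A x y : K^o| <= M * `|x|.
Proof.
exists (`|A| * `|y|) => x; rewrite (le_trans (op_normM (A x) y))//.
by rewrite mulrAC ler_wpM2r// op_normM.
Qed.

Definition flip1 (y : F) : dual E := mk_op (@flip1_linear y) (flip1_bounded y).

Lemma flip_linear : linear flip1.
Proof. by move=> a y z; apply: op_ext => x; rewrite /= (op_linear (A x)). Qed.

Lemma flip_bounded : exists M : K, forall y, `|flip1 y| <= M * `|y|.
Proof.
exists `|A| => y; apply: op_norm_le => [|x /=]; first by rewrite mulr_ge0.
rewrite (le_trans (op_normM (A x) y))//.
by rewrite mulrAC ler_wpM2r// op_normM.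
Qed.

(* An operator into a dual space is a bounded bilinear form; exchange its two
   arguments. *)
Definition op_flip : bounded_op F (dual E) := mk_op flip_linear flip_bounded.

End flip.

Lemma op_compE E F G (A : bounded_op F G) (B : bounded_op E F) x :
  op_comp A B x = A (B x).
Proof. by []. Qed.

Lemma op_flipE E F (A : bounded_op E (dual F)) x y : op_flip A y x = A x y.
Proof. by []. Qed.

Lemma op_comp_linearr E F G (A : bounded_op F G) : linear (@op_comp E F G A).
Proof.
by move=> a U V; apply: op_ext => x; rewrite !op_compE (op_linear A).
Qed.

Lemma op_flip_linear E F : linear (@op_flip E F).
Proof.
move=> a A B; apply: op_ext => y; apply: op_ext => x.
by rewrite op_flipE !add_opE !scale_opE !op_flipE.
Qed.

Definition bidual_embedding E : bounded_op E (dual (dual E)) :=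
  op_flip (op_id (dual E)).

Lemma bidual_embeddingE E (x : E) (f : dual E) : bidual_embedding E x f = f x.
Proof. by []. Qed.

Definition adjoint E F (A : bounded_op E F) : bounded_op (dual F) (dual E) :=
  op_flip (op_comp (bidual_embedding F) A).

Lemma adjointE E F (A : bounded_op E F) (f : dual F) x :
  adjoint A f x = f (A x).
Proof. by []. Qed.

Lemma adjoint_comp E F G (A : bounded_op F G) (B : bounded_op E F) f :
  adjoint (op_comp A B) f = adjoint B (adjoint A f).
Proof. by apply: op_ext => x; rewrite !adjointE. Qed.

End operator_constructions.

Section semigroups.
Context {R : realType} {k : scalar_kind}.
Local Notation K := (scalars R k).

(* The filter "t -> 0" on [0, +oo[. *)
Definition time0 : set_system {nonneg R} :=
  nbhs (0%:nng : initial_topology (fun t : {nonneg R} => t%:num)).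

Global Instance time0_filter : Filter time0.
Proof.
exact: (@nbhs_filter (initial_topology (fun t : {nonneg R} => t%:num))).
Qed.

Record c0_semigroup (X : normedModType K) := C0Semigroup {
  c0_op :> {nonneg R} -> bounded_op X X;
  c0_op0 : c0_op 0%:nng = op_id X;
  c0_opD : forall s t,
    c0_op (s%:num + t%:num)%:nng = op_comp (c0_op s) (c0_op t);
  c0_cvg : forall x, c0_op t x @[t --> time0] --> x }.

Definition bounded_semigroup (X : normedModType K) (T : c0_semigroup X) : Prop :=
  exists M : K, forall t, `|T t| <= M.

Section strong_continuity.
Variables (E : normedModType K) (S : {nonneg R} -> bounded_op E E).

Definition strong_pred : {pred E} :=
  mem [set x | S t x @[t --> time0] --> x].

Lemma strong_submod_closed : submod_closed strong_pred.
Proof.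
split.
  rewrite inE /=; have -> : (fun t => S t 0) = cst 0.
    by apply/funext => t; rewrite op0.
  exact: cvg_cst.
move=> a x y; rewrite !inE /= => Sx Sy.
have -> : (fun t => S t (a *: x + y)) = (fun t => a *: S t x + S t y).
  by apply/funext => t; rewrite op_linear.
by apply: cvgD => //; exact: cvgZl_tmp.
Qed.

HB.instance Definition _ := GRing.isSubmodClosed.Build K E
  strong_pred strong_submod_closed.

(* The subspace on which S is strongly continuous, with the norm of E. *)
Record strong_space := StrongSpace {
  strong_val : E;
  strong_valP : strong_val \in strong_pred }.

HB.instance Definition _ := [isSub for strong_val].
HB.instance Definition _ := [Choice of strong_space by <:].
HB.instance Definition _ := [SubChoice_isSubLmodule of strong_space by <:].

Let strong_norm (x : strong_space) : K := `|val x|.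

Let strong_normD x y : strong_norm (x + y) <= strong_norm x + strong_norm y.
Proof. exact: ler_normD. Qed.

Let strong_normZ a x : strong_norm (a *: x) = `|a| * strong_norm x.
Proof. exact: normrZ. Qed.

Let strong_norm0_eq0 x : strong_norm x = 0 -> x = 0.
Proof. by move/normr0_eq0 => x0; exact: val_inj. Qed.

HB.instance Definition _ := @Lmodule_isNormed.Build K strong_space
  strong_norm strong_normD strong_normZ strong_norm0_eq0.

Lemma strong_normE (x : strong_space) : `|x| = `|val x|. Proof. by []. Qed.

Lemma strong_incl_bounded :
  exists M : K, forall x : strong_space, `|val x| <= M * `|x|.
Proof. by exists 1 => x; rewrite mul1r. Qed.

Definition strong_incl : bounded_op strong_space E :=
  @mk_op R k strong_space E val (fun _ _ _ => erefl) strong_incl_bounded.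

Lemma strong_val_inj : injective strong_val.
Proof. exact: val_inj. Qed.

Lemma strong_inclE x : strong_incl x = strong_val x.
Proof. by []. Qed.

Section corestriction.
Variables (F : normedModType K) (A : bounded_op F E).
Hypothesis AS : forall x, A x \in strong_pred.

Lemma strong_corestr_linear : linear (fun x => StrongSpace (AS x)).
Proof. by move=> a x y; apply: val_inj; rewrite /= (op_linear A). Qed.

Lemma strong_corestr_bounded :
  exists M : K, forall x, `|StrongSpace (AS x)| <= M * `|x|.
Proof. by exists `|A| => x; exact: op_normM. Qed.

Definition strong_corestr : bounded_op F strong_space :=
  mk_op strong_corestr_linear strong_corestr_bounded.

Lemma strong_corestrE x : strong_val (strong_corestr x) = A x.
Proof. by []. Qed.

End corestriction.

Lemma op_cvg (F : normedModType K) (A : bounded_op E F) (I : Type)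
    (G : set_system I) (f : I -> E) (l : E) : Filter G ->
  f @ G --> l -> A (f i) @[i --> G] --> A l.
Proof.
move=> FG /cvgrPdist_le fl; apply/cvgrPdist_le => e e0.
have A1 : 0 < `|A| + 1 by rewrite ltr_wpDl.
apply: filterS (fl (e / (`|A| + 1)) (divr_gt0 e0 A1)) => i.
rewrite ler_pdivlMr// mulrC -opB; apply: le_trans.
by rewrite (le_trans (op_normM _ _))// ler_wpM2r// lerDl.
Qed.

Lemma strong_commute (A : bounded_op E E) x :
    (forall t y, S t (A y) = A (S t y)) ->
  x \in strong_pred -> A x \in strong_pred.
Proof.
rewrite !inE /= => SA Sx.
have := op_cvg (A := A) time0_filter Sx.
by have -> : (fun t => S t (A x)) = (fun t => A (S t x)) by exact/funext.
Qed.

End strong_continuity.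

End semigroups.

Arguments time0 {R}.

Section sun_duals.
Context {R : realType} {k : scalar_kind}.
Local Notation K := (scalars R k).
Variables (X : normedModType K) (T : c0_semigroup X).

Lemma c0_commute s t x : T s (T t x) = T t (T s x).
Proof.
rewrite -!op_compE -!c0_opD; congr (T _ x).
by apply: val_inj; rewrite /= addrC.
Qed.

Definition sun_pred : {pred dual X} := strong_pred (fun t => adjoint (T t)).

Definition sun_dual : normedModType K := strong_space (fun t => adjoint (T t)).

Definition sun_incl : bounded_op sun_dual (dual X) := strong_incl _.

Lemma adjoint_sun t (y : sun_dual) : adjoint (T t) (strong_val y) \in sun_pred.
Proof.
apply: strong_commute; last exact: strong_valP.
by move=> s z; apply: op_ext => x; rewrite !adjointE c0_commute.
Qed.

Definition sun_semigroup t : bounded_op sun_dual sun_dual :=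
  strong_corestr (A := op_comp (adjoint (T t)) sun_incl) (adjoint_sun t).

Lemma sun_semigroupE t (y : sun_dual) x : strong_val (sun_semigroup t y) x = strong_val y (T t x).
Proof. by []. Qed.

Definition sunsun_pred : {pred dual sun_dual} :=
  strong_pred (fun t => adjoint (sun_semigroup t)).

Definition sunsun_dual : normedModType K :=
  strong_space (fun t => adjoint (sun_semigroup t)).

Definition sunsun_incl : bounded_op sunsun_dual (dual sun_dual) :=
  strong_incl _.

Lemma sunsun_embedding_subproof x :
  adjoint sun_incl (bidual_embedding X x) \in sunsun_pred.
Proof.
rewrite inE /=; apply/cvgrPdist_le => e e0.
have /cvgrPdist_le/(_ e e0) := @c0_cvg _ _ _ T x; apply: filterS => t Ttx.
apply: op_norm_le => [|y]; first exact: ltW.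
rewrite -[leLHS]/(`|strong_val y x - strong_val y (T t x) : K^o|) -opB.
by rewrite (le_trans (op_normM _ _))// mulrC ler_wpM2r.
Qed.

(* x, seen as the functional <x, .> on the sun dual. *)
Definition sunsun_embedding : bounded_op X sunsun_dual :=
  strong_corestr (A := op_comp (adjoint sun_incl) (bidual_embedding X))
    sunsun_embedding_subproof.

Lemma sunsun_embeddingE x y : strong_val (sunsun_embedding x) y = strong_val y x.
Proof. by []. Qed.

(* U^* on the sun dual, with values in X^*. *)
Definition sun_adjoint (U : bounded_op X sunsun_dual) :
    bounded_op sun_dual (dual X) :=
  op_flip (op_comp sunsun_incl U).

Lemma sun_adjointE U y x : sun_adjoint U y x = strong_val (U x) y.
Proof. by []. Qed.

Lemma sun_adjoint_linear : linear sun_adjoint.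
Proof.
by move=> a U V; rewrite /sun_adjoint op_comp_linearr op_flip_linear.
Qed.

(* The operator strong_corestr h is U^sun. *)
Definition LT_XXss_pred : {pred bounded_op X sunsun_dual} :=
  mem [set U | exists h : forall y, sun_adjoint U y \in sun_pred,
    forall phi : sunsun_dual,
      adjoint (strong_corestr h) (strong_val phi) \in sunsun_pred].

Lemma LT_XXss_submod_closed : submod_closed LT_XXss_pred.
Proof.
split.
  have h y : sun_adjoint 0 y \in sun_pred.
    by rewrite (_ : sun_adjoint 0 y = 0) ?rpred0//; exact: op_ext.
  rewrite inE; exists h => phi; rewrite (_ : adjoint _ _ = 0) ?rpred0//.
  apply: op_ext => y; rewrite adjointE (_ : strong_corestr h y = 0) ?op0//.
  by apply: val_inj; exact: op_ext.
move=> a U V; rewrite !inE => -[hU HU] [hV HV].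
have UVE y : sun_adjoint (a *: U + V) y = a *: sun_adjoint U y + sun_adjoint V y.
  by rewrite sun_adjoint_linear.
have h y : sun_adjoint (a *: U + V) y \in sun_pred.
  by rewrite UVE; apply: rpredD; [apply: rpredZ; exact: hU|exact: hV].
exists h => phi.
rewrite (_ : adjoint _ _ = a *: adjoint (strong_corestr hU) (strong_val phi)
                           + adjoint (strong_corestr hV) (strong_val phi)).
  by apply: rpredD; [apply: rpredZ; exact: HU|exact: HV].
apply: op_ext => y; rewrite add_opE scale_opE !adjointE -opZ -opD.
congr (strong_val phi _); apply: strong_val_inj.
rewrite strong_corestrE UVE -[RHS]strong_inclE op_linear !strong_inclE.
by rewrite !strong_corestrE.
Qed.

HB.instance Definition _ := GRing.isSubmodClosed.Build K
  (bounded_op X sunsun_dual) LT_XXss_pred LT_XXss_submod_closed.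

Record LT_XXss := LTXXss {
  LT_XXss_val :> bounded_op X sunsun_dual;
  LT_XXss_valP : LT_XXss_val \in LT_XXss_pred }.

HB.instance Definition _ := [isSub for LT_XXss_val].
HB.instance Definition _ := [Choice of LT_XXss by <:].
HB.instance Definition _ := [SubChoice_isSubLmodule of LT_XXss by <:].

Lemma LT_XXss_sun (U : LT_XXss) y : sun_adjoint U y \in sun_pred.
Proof. by have := LT_XXss_valP U; rewrite inE => -[h _]; exact: h. Qed.

Definition sun_op (U : LT_XXss) : bounded_op sun_dual sun_dual :=
  strong_corestr (LT_XXss_sun U).

Lemma sun_opE (U : LT_XXss) y x : strong_val (sun_op U y) x = strong_val (U x) y.
Proof. by []. Qed.

Lemma LT_XXss_sunsun (U : LT_XXss) (phi : sunsun_dual) :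
  adjoint (sun_op U) (strong_val phi) \in sunsun_pred.
Proof.
have := LT_XXss_valP U; rewrite inE => -[h /(_ phi)].
by rewrite (Prop_irrelevance h (LT_XXss_sun U)).
Qed.

Lemma LT_XXss_comp_subproof (U V : LT_XXss) :
  strong_corestr
    (A := op_comp (adjoint (sun_op U)) (op_comp sunsun_incl (V : bounded_op X sunsun_dual)))
    (fun x => LT_XXss_sunsun U (V x)) \in LT_XXss_pred.
Proof.
rewrite inE; set W := strong_corestr _.
have WE y : sun_adjoint W y = sun_adjoint V (sun_op U y) by exact: op_ext.
have h y : sun_adjoint W y \in sun_pred by rewrite WE; exact: LT_XXss_sun.
exists h => phi.
have psi : {psi : sunsun_dual | strong_val psi = adjoint (sun_op V) (strong_val phi)}.
  by exists (StrongSpace (LT_XXss_sunsun V phi)).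
rewrite (_ : adjoint _ _ = adjoint (sun_op U) (strong_val (sval psi))).
  exact: LT_XXss_sunsun.
rewrite (svalP psi); apply: op_ext => y; rewrite !adjointE.
congr (strong_val phi _); apply: strong_val_inj.
by rewrite !strong_corestrE WE.
Qed.

(* (U o V) x is the functional y |-> <V x, U^sun y>. *)
Definition LT_XXss_comp (U V : LT_XXss) : LT_XXss :=
  LTXXss (LT_XXss_comp_subproof U V).

Lemma LT_XXss_compE U V x y :
  strong_val (LT_XXss_comp U V x) y = strong_val (V x) (sun_op U y).
Proof. by []. Qed.

Definition LT_sun_pred : {pred bounded_op sun_dual sun_dual} :=
  mem [set A | forall phi : sunsun_dual, adjoint A (strong_val phi) \in sunsun_pred].

Lemma LT_sun_submod_closed : submod_closed LT_sun_pred.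
Proof.
split.
  rewrite inE => phi; rewrite (_ : adjoint _ _ = 0) ?rpred0//.
  by apply: op_ext => y; rewrite adjointE op0.
move=> a A B; rewrite !inE => HA HB phi.
rewrite (_ : adjoint _ _ = a *: adjoint A (strong_val phi) + adjoint B (strong_val phi)).
  by apply: rpredD; [apply: rpredZ; exact: HA|exact: HB].
by apply: op_ext => y; rewrite add_opE scale_opE !adjointE -opZ -opD.
Qed.

HB.instance Definition _ := GRing.isSubmodClosed.Build K
  (bounded_op sun_dual sun_dual) LT_sun_pred LT_sun_submod_closed.

Record LT_sun := LTSun {
  LT_sun_val :> bounded_op sun_dual sun_dual;
  LT_sun_valP : LT_sun_val \in LT_sun_pred }.

HB.instance Definition _ := [isSub for LT_sun_val].
HB.instance Definition _ := [Choice of LT_sun by <:].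
HB.instance Definition _ := [SubChoice_isSubLmodule of LT_sun by <:].

Lemma LT_sun_comp_subproof (A B : LT_sun) :
  op_comp (A : bounded_op sun_dual sun_dual) B \in LT_sun_pred.
Proof.
have := LT_sun_valP A; have := LT_sun_valP B; rewrite !inE => HB HA phi.
rewrite adjoint_comp; exact: HB (StrongSpace (HA phi)).
Qed.

Definition LT_sun_comp (A B : LT_sun) : LT_sun :=
  LTSun (LT_sun_comp_subproof A B).

Lemma eta_sun_subproof (V : LT_XXss) : sun_op V \in LT_sun_pred.
Proof. by rewrite inE => phi; exact: LT_XXss_sunsun. Qed.

(* V |-> V^* restricted to the sun dual. *)
Definition eta_sun (V : LT_XXss) : LT_sun := LTSun (eta_sun_subproof V).

Lemma eta_sunE (V : LT_XXss) y x : strong_val (eta_sun V y) x = strong_val (V x) y.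
Proof. by []. Qed.

Lemma LT_semigroup_subproof t :
  op_comp sunsun_embedding (T t) \in LT_XXss_pred.
Proof.
rewrite inE; set W := op_comp _ _.
have WE y : sun_adjoint W y = adjoint (T t) (strong_val y) by exact: op_ext.
have h y : sun_adjoint W y \in sun_pred by rewrite WE; exact: adjoint_sun.
exists h => phi.
rewrite (_ : adjoint _ _ = adjoint (sun_semigroup t) (strong_val phi)).
  apply: strong_commute; last exact: strong_valP.
  move=> s psi; apply: op_ext => y; rewrite !adjointE.
  congr (psi _); apply: val_inj; apply: op_ext => x.
  by rewrite !sun_semigroupE c0_commute.
apply: op_ext => y; rewrite !adjointE.
congr (strong_val phi _); apply: strong_val_inj.
by rewrite !strong_corestrE WE.
Qed.

(* T(t), seen as an operator from X to X^{sun sun}. *)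
Definition LT_semigroup t : LT_XXss := LTXXss (LT_semigroup_subproof t).

End sun_duals.

Arguments sunsun_pred {R k X} T _.
Arguments LT_XXss_pred {R k X} T _.
Arguments LT_sun_pred {R k X} T _.

Section hulls.
Context {K : numFieldType} {E : lmodType K}.

Definition absolutely_convex (A : set E) : Prop :=
  convex_set (A : set (convex_lmodType E)) /\
  forall (a : K) x, `|a| <= 1 -> A x -> A (a *: x).

Definition convex_hull (A : set E) : set E :=
  smallest [set B | convex_set (B : set (convex_lmodType E))] A.

Definition absolutely_convex_hull (A : set E) : set E :=
  smallest absolutely_convex A.

End hulls.

Section operator_topologies.
Context {R : realType} {k : scalar_kind}.
Local Notation K := (scalars R k).

(* w*OT on L(E, F^* ): the initial topology for the maps A |-> <A x, y>. *)
Definition wstar_OT (E F : normedModType K) : topologicalType :=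
  initial_topology (fun A : bounded_op E (dual F) =>
    (fun xy => A xy.1 xy.2) : {ptws E * F -> K^o}).

Variables (X : normedModType K) (T : c0_semigroup X).

Definition kappa_sun : topologicalType :=
  initial_topology (fun A : bounded_op (sun_dual T) (sun_dual T) =>
    (fun yx => strong_val (A yx.1) yx.2) : {ptws sun_dual T * X -> K^o}).

Definition kappa_LT_sun : topologicalType :=
  initial_topology (fun A : LT_sun T =>
    (A : bounded_op (sun_dual T) (sun_dual T)) : kappa_sun).

Definition kappa_sunsun : topologicalType :=
  initial_topology (fun U : LT_XXss T =>
    (fun xy => strong_val (U xy.1) xy.2) : {ptws X * sun_dual T -> K^o}).

End operator_topologies.

Section compactifications.
Context {R : realType} {k : scalar_kind}.
Local Notation K := (scalars R k).
Variable X : normedModType K.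

(* eta : L(X, X^** ) -> L(X^* ) *)
Definition eta (U : bounded_op X (dual (dual X))) :
    bounded_op (dual X) (dual X) :=
  op_flip U.

(* V_0, for a set V of operators on X; L(X) is embedded in L(X, X^** ). *)
Definition compactification (V : set (bounded_op X X)) :
    set (bounded_op X (dual (dual X))) :=
  eta @^-1` closure
    (eta @` (op_comp (bidual_embedding X) @` V) : set (wstar_OT (dual X) X)).

Variable T : c0_semigroup X.

Definition semigroup_set : set (bounded_op X X) := range T.

Definition S_0 := compactification semigroup_set.
Definition T_0 := compactification (convex_hull semigroup_set).
Definition U_0 := compactification (absolutely_convex_hull semigroup_set).

Definition S_sun : set (bounded_op (sun_dual T) (sun_dual T)) :=
  range (sun_semigroup T).
Definition T_sun := convex_hull S_sun.
Definition U_sun := absolutely_convex_hull S_sun.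

(* U x restricted to the sun dual. *)
Definition sun_restriction (U : bounded_op X (dual (dual X))) :
    bounded_op X (dual (sun_dual T)) :=
  op_comp (adjoint (sun_incl T)) U.

(* The image under eta_sun of a set W of operators from X to X^** whose
   restrictions lie in L_T(X, X^{sun sun}). *)
Definition eta_sun_image (W : set (bounded_op X (dual (dual X)))) :
    set (bounded_op (sun_dual T) (sun_dual T)) :=
  [set (eta_sun V : bounded_op _ _) | V in
    [set V : LT_XXss T | exists2 U, W U &
       op_comp (sunsun_incl T) V = sun_restriction U]].

Definition S_0_sun := eta_sun_image S_0.
Definition T_0_sun := eta_sun_image T_0.
Definition U_0_sun := eta_sun_image U_0.

End compactifications.

Arguments S_0 {R k X} T _.
Arguments T_0 {R k X} T _.
Arguments U_0 {R k X} T _.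
Arguments S_sun {R k X} T _.
Arguments T_sun {R k X} T _.
Arguments U_sun {R k X} T _.
Arguments eta_sun_image {R k X} T _.
Arguments S_0_sun {R k X} T _.
Arguments T_0_sun {R k X} T _.
Arguments U_0_sun {R k X} T _.

Section restriction_of_compactification.
Context {R : realType} {k : scalar_kind}.
Local Notation K := (scalars R k).
Variables (X : normedModType K) (T : c0_semigroup X).

Let wstar_eval (E F : normedModType K) (p : E * F) :
  continuous (fun A : wstar_OT E F => (A : bounded_op E (dual F)) p.1 p.2 : K^o).
Proof.
pose f (A : bounded_op E (dual F)) : {ptws E * F -> K^o} :=
  fun xy => A xy.1 xy.2.
move=> A; apply: (@continuous_comp (wstar_OT E F) {ptws E * F -> K^o} K^o f
  (fun g => g p)); first exact: (@initial_continuous _ _ f).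
exact: (@proj_continuous _ (fun=> K^o) p).
Qed.

Let closure_approx (Z : topologicalType) (W : set Z) (g : Z -> K^o) B :
  continuous g -> closure W B ->
  forall e : K, 0 < e -> exists2 A, W A & `|g B - g A| <= e.
Proof.
move=> gc WB e e0; have /cvgrPdist_le/(_ e e0) := gc B.
by move=> /WB[A [WA gA]]; exists A.
Qed.

Let hull_commute (V : bounded_op X X) :
  absolutely_convex_hull (semigroup_set T) V -> forall s x, V (T s x) = T s (V x).
Proof.
move=> HV; pose G := [set V : bounded_op X X | forall s x, V (T s x) = T s (V x)].
apply: (HV G); split=> [|_ [t _ <-] s x]; last exact: c0_commute.
split=> [A B l /[!inE] HA HB s x|a A a1 HA s x].
  rewrite -[LHS]/(l%:num *: A (T s x) + (1 - l%:num) *: B (T s x)).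
  rewrite -[in RHS]/(T s (l%:num *: A x + (1 - l%:num) *: B x)).
  by rewrite opD !opZ HA HB.
by rewrite !scale_opE HA opZ.
Qed.

Let hull_bounded M (V : bounded_op X X) : (forall t, `|T t| <= M) ->
  absolutely_convex_hull (semigroup_set T) V -> `|V| <= M.
Proof.
move=> TM HV; apply: (HV [set V | `|V| <= M]); split=> [|_ [t _ <-]]; last exact: TM.
split=> [A B l /[!inE] /= HA HB|a A a1 /= HA].
  pose AB : bounded_op X X := l%:num *: (A : bounded_op X X) + (1 - l%:num) *: B.
  rewrite -[leLHS]/(`|AB|) /AB.
  rewrite (le_trans (ler_normD _ _))// !normrZ.
  have l1 : 0 <= 1 - l%:num by rewrite subr_ge0 le1.
  have -> : M = l%:num * M + (1 - l%:num) * M by rewrite mulrBl mul1r subrKC.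
  apply: lerD; rewrite ger0_norm//.
    by apply: ler_wpM2l => //; exact: HA.
  by apply: ler_wpM2l => //; exact: HB.
by rewrite normrZ (le_trans _ HA)// ler_piMl.
Qed.

Lemma U_0_commute U : U_0 T U ->
  forall s x (f : dual X), U (T s x) f = U x (adjoint (T s) f).
Proof.
move=> HU s x f; apply/eqP; rewrite -subr_eq0 -normr_le0.
apply/ler_addgt0Pl => e e0; rewrite addr0.
pose g (A : wstar_OT (dual X) X) : K^o := (A : bounded_op (dual X) (dual X)) f (T s x) -
  (A : bounded_op (dual X) (dual X)) (adjoint (T s) f) x.
have gc : continuous g.
  move=> A; apply: cvgB; first exact: (@nbhs_filter (wstar_OT (dual X) X)).
    exact: (@wstar_eval (dual X) X (f, T s x) A).
  exact: (@wstar_eval (dual X) X (adjoint (T s) f, x) A).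
have [_ [_ [V HV <-] <-]] := closure_approx gc HU e0.
rewrite [X in _ - X](_ : _ = 0) ?subr0//.
rewrite /g -[LHS]/(f (V (T s x)) - f (T s (V x))) hull_commute//.
by rewrite subrr.
Qed.

Lemma U_0_bounded (M : K) U : (forall t, `|T t| <= M) -> U_0 T U ->
  forall x (f : dual X), `|U x f : K^o| <= M * `|x| * `|f|.
Proof.
move=> TM HU x f; apply/ler_addgt0Pr => e e0.
have [_ [_ [V HV <-] <-]] := closure_approx (@wstar_eval (dual X) X (f, x)) HU e0.
rewrite -[X in _ - X]/(f (V x)) -[X in X - _]/(U x f) => H.
rewrite -[U x f](subrK (f (V x))) addrC (le_trans (ler_normD _ _))//.
rewrite lerD// (le_trans (op_normM _ _))// mulrC ler_wpM2r//.
by rewrite (le_trans (op_normM _ _))// ler_wpM2r// (hull_bounded TM).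
Qed.

(* The inclusion U_0 `<=` L_T(X, X^{sun sun}) (after restriction), hence also
   that of S_0 and T_0, subsets of U_0: eta_sun_image loses no operator. *)
Lemma U_0_LT U : bounded_semigroup T -> U_0 T U ->
  exists V : LT_XXss T, op_comp (sunsun_incl T) V = sun_restriction T U.
Proof.
move=> [M TM] HU.
have M0 : 0 <= M by exact: le_trans (TM 0%:nng).
have UC := U_0_commute HU; have UB := U_0_bounded TM HU.
have h1 x : sun_restriction T U x \in sunsun_pred T.
  rewrite inE /=; apply/cvgrPdist_le => e e0.
  have M1 : 0 < M + 1 by rewrite ltr_wpDl.
  have /cvgrPdist_le/(_ _ (divr_gt0 e0 M1)) := @c0_cvg _ _ _ T x.
  apply: filterS => t; rewrite ler_pdivlMr// => Ttx.
  apply: op_norm_le => [|y]; first exact: ltW.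
  rewrite -[leLHS]/(`|U x (strong_val y) - U x (adjoint (T t) (strong_val y)) : K^o|) -UC.
  rewrite -[X in `|X|]/((U x - U (T t x)) (strong_val y)) -opB (le_trans (UB _ _))//.
  rewrite ler_wpM2r// (le_trans _ Ttx)// mulrC ler_wpM2l// lerDl//.
pose V := strong_corestr (A := sun_restriction T U) h1.
have h y : sun_adjoint V y \in sun_pred T.
  rewrite inE /=; apply/cvgrPdist_le => e e0.
  have M1 : 0 < M + 1 by rewrite ltr_wpDl.
  have := strong_valP y; rewrite inE /= => /cvgrPdist_le/(_ _ (divr_gt0 e0 M1)).
  apply: filterS => t; rewrite ler_pdivlMr// => Tty.
  apply: op_norm_le => [|x]; first exact: ltW.
  rewrite -[leLHS]/(`|U x (strong_val y) - U (T t x) (strong_val y) : K^o|) UC -opB.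
  rewrite (le_trans (UB _ _))// mulrAC ler_wpM2r// (le_trans _ Tty)//.
  by rewrite mulrC ler_wpM2l// lerDl.
suff VLT : V \in LT_XXss_pred T by exists (LTXXss VLT); exact: op_ext.
rewrite inE; exists h => phi; apply: strong_commute; last exact: strong_valP.
move=> t psi; apply: op_ext => y; rewrite !adjointE; congr (psi _).
apply: val_inj; apply: op_ext => x.
by rewrite sun_semigroupE -[LHS]/(U x (adjoint (T t) (strong_val y))) -UC.
Qed.

End restriction_of_compactification.

(* Main.v *)
(* The identity <x, eta_sun(V) y> = <V x, y> makes (1) and (2) a matter of
   unfolding; an operator A in L_T(X^sun) is the image of x |-> A^*(x).

   For (3), an operator on X^* is identified with the scalar function
   (f, x) |-> <x, A f> on X^* x X. The closure of a bounded family is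
   w*OT-compact (Banach-Alaoglu), and restricting functions to X^sun x X is
   continuous and maps that closure onto the functions given by eta_sun(V_0).
   This yields compactness and density at once. Convexity passes to the closure
   because linear combinations are separately continuous. *)

Require Import Defs.
From HB Require Import structures.
From mathcomp Require Import all_boot all_order all_algebra.
From mathcomp Require Import complex.
From mathcomp Require Import all_classical all_reals all_analysis.

Import Order.TTheory GRing.Theory Num.Theory.
Import numFieldNormedType.Exports.

Local Open Scope classical_set_scope.
Local Open Scope ring_scope.

(** * Closed conditions and compact scalar discs *)

Lemma closed_norm_le (K : numFieldType) (Z : topologicalType) (V : normedModType K)
    (g : Z -> V) (M : K) :
  continuous g -> closed [set z | `|g z| <= M].
Proof.
(* Norms take values in [K], which may be only partially ordered, so the bound at a limit point is
   obtained up to each positive margin [e]. *)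
move=> gc z Wz; apply/ler_addgt0Pr => e e0.
have /cvgrPdist_le/(_ e e0) := gc z.
move=> /Wz[w [/= wM gzw]].
by rewrite -[g z](subrK (g w)) addrC (le_trans (ler_normD _ _))// lerD.
Qed.

(** A map is linear when all such defects vanish, and vanishing of a continuous defect survives
    pointwise limits. *)
Lemma continuous_linear_defect (K : numFieldType) (Z : topologicalType)
    (V : normedModType K) (a : K) (f g h : Z -> V) :
  continuous f -> continuous g -> continuous h ->
  continuous (fun z => f z - (a *: g z + h z)).
Proof.
move=> fc gc hc z; apply: cvgB; first exact: fc.
by apply: cvgD; [apply: cvgZl_tmp; exact: gc|exact: hc].
Qed.

Lemma continuous_affine (K : numFieldType) (Z : topologicalType)
    (V : normedModType K) (f : Z -> V) (a : K) (c : V) :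
  continuous f -> continuous (fun z => a *: f z + c).
Proof.
by move=> fc z; apply: cvgD; [apply: cvgZl_tmp; exact: fc|exact: cvg_cst].
Qed.

(** The disc is closed and lies in the square of half-side [m], which is the continuous image of a
    product of two compact real segments. *)
Lemma complex_disc_compact (R : realType) (M : R[i]) :
  compact [set z : R[i]^o | `|z| <= M].
Proof.
pose m := complex.Re M.
pose h (p : R^o * R^o) : R[i]^o := (p.1 +i* p.2)%C.
have hc : continuous h.
  move=> p; apply/cvgrPdist_le => /= e e0.
  (* A positive element of [R[i]] is real, so [e] can be halved in [R] and shared between the two
     coordinates. *)
  have [er epos] : e = (complex.Re e)%:C%C /\ 0 < complex.Re e.
    by case: e e0 => a b; rewrite ltcE /= => /andP[/eqP -> ?].
  have e2 : 0 < complex.Re e / 2 by rewrite divr_gt0.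
  have normRi (a b : R) : `|(a +i* b)%C| <= (`|a| + `|b|)%:C%C :> R[i].
    rewrite [(a +i* b)%C]complexE; apply: (le_trans (ler_normD _ _)).
    rewrite normrM normc_def /= expr0n /=.
    rewrite addr0 sqrtr_sqr normc_def /= expr0n /= add0r expr1n sqrtr1 mul1r.
    by rewrite normc_def /= expr0n /= addr0 sqrtr_sqr -rmorphD.
  near=> q.
  apply: (le_trans (normRi (p.1 - q.1) (p.2 - q.2))).
  rewrite er lecR /= (splitr (complex.Re e)) lerD//.
  - near: q; have c1 : (z.1 : R^o) @[z --> p] --> p.1 by exact: cvg_fst.
    by have /cvgrPdist_le/(_ _ e2) := c1.
  - near: q; have c2 : (z.2 : R^o) @[z --> p] --> p.2 by exact: cvg_snd.
    by have /cvgrPdist_le/(_ _ e2) := c2.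
have cI : compact (`[- m, m]%classic : set R^o) by exact: segment_compact.
have cQ := continuous_compact (continuous_subspaceT hc) (compact_setX cI cI).
apply: (subclosed_compact _ cQ).
  by apply: (@closed_norm_le _ _ R[i]^o id) => z; exact: cvg_id.
move=> [a b] /= zM; exists (a, b) => //=.
have M0 := le_trans (normr_ge0 _) zM.
have {}zM : Num.sqrt (a ^+ 2 + b ^+ 2) <= m.
  by move: zM; rewrite normc_def lecE /= => /andP[].
rewrite !in_itv /= -!ler_norml; split.
- by rewrite (le_trans _ zM)// -sqrtr_sqr ler_wsqrtr// lerDl sqr_ge0.
- by rewrite (le_trans _ zM)// -sqrtr_sqr ler_wsqrtr// lerDr sqr_ge0.
Unshelve. all: by end_near. Qed.

Lemma scalar_disc_compact (R : realType) (k : scalar_kind) (M : scalars R k) :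
  compact [set z : (scalars R k)^o | `|z| <= M].
Proof.
case: k M => /= M; last exact: complex_disc_compact.
have := @segment_compact R (- M) M; congr compact.
by apply/seteqP; split=> x /=; rewrite in_itv/= -ler_norml.
Qed.

(** * Initial and pointwise topologies *)

Lemma initial_closure (S : choiceType) (Z : topologicalType) (f : S -> Z)
    (A : set S) :
  closure (A : set (initial_topology f)) = f @^-1` closure (f @` A).
Proof.
apply/seteqP; split=> [s As B fsB|s As B].
  have /As[t [At Bt]] : nbhs (s : initial_topology f) (f @^-1` B).
    exact: (@initial_continuous _ _ f).
  by exists (f t); split => //; exists t.
rewrite nbhsE => -[_ [[C Co <-] Cs] CB].
have /As[_ [[t At <-] Ct]] : nbhs (f s) C by exact: open_nbhs_nbhs.
by exists t; split => //; exact: CB.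
Qed.

(** A filter on [A] is pushed forward along [f]; its cluster point has the form [f s] with [s] in
    [A], and [s] is a cluster point upstairs because basic neighbourhoods there are preimages of
    open sets. *)
Lemma initial_compact (S : choiceType) (Z : topologicalType) (f : S -> Z)
    (A : set S) :
  compact (f @` A) -> compact (A : set (initial_topology f)).
Proof.
move=> fA F PF FA.
have fFA : F (f @^-1` (f @` A)) by apply: (filterS _ FA); exact: preimage_image.
have [_ [[s As <-] cs]] := fA (f @ F) _ fFA.
exists s; split => // B N FB; rewrite nbhsE => -[_ [[C Co <-] Cs] CN].
have fFB : F (f @^-1` (f @` B)) by apply: (filterS _ FB); exact: preimage_image.
have [_ [[t Bt <-] Ct]] := cs _ C fFB (open_nbhs_nbhs (conj Co Cs)).
by exists t; split => //; exact: CN.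
Qed.

Lemma continuous_to_initial (S : choiceType) (Z Y : topologicalType)
    (f : S -> Z) (g : Y -> S) :
  continuous (f \o g) -> continuous (g : Y -> initial_topology f).
Proof.
move=> /continuousP fg; apply/continuousP => _ [B oB <-]; exact: fg.
Qed.

Lemma ptws_continuous (Y : topologicalType) (I : Type) (Z : topologicalType)
    (g : Y -> {ptws I -> Z}) :
  (forall i, continuous (fun y => g y i)) -> continuous g.
Proof.
move=> gc y; apply/cvg_sup => i N /= [_ [[C Co <-] Cy CN]].
apply: (@filterS Y (nbhs y) _ ((fun z => g z i) @^-1` C)) => [z /CN//|].
exact: (gc i y C (open_nbhs_nbhs (conj Co Cy))).
Qed.

(** * Pairings of linear combinations *)

Lemma op_linear_comb (R : realType) (k : scalar_kind)
    (E F : normedModType (scalars R k)) (A B : bounded_op E F)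
    (a b : scalars R k) x :
  (a *: A + b *: B) x = a *: A x + b *: B x.
Proof. by rewrite add_opE !scale_opE. Qed.

Lemma strong_val_linear_comb (R : realType) (k : scalar_kind)
    (E : normedModType (scalars R k)) (S : {nonneg R} -> bounded_op E E)
    (u v : strong_space S) (a b : scalars R k) :
  strong_val (a *: u + b *: v) = a *: strong_val u + b *: strong_val v.
Proof. by []. Qed.

Lemma bilinear_comb (R : realType) (k : scalar_kind)
    (E F : normedModType (scalars R k)) (A B : bounded_op E (dual F))
    (a b : scalars R k) x y :
  (a *: A + b *: B) x y =
  a *: (A x y : (scalars R k)^o) + b *: (B x y : (scalars R k)^o).
Proof. by rewrite !op_linear_comb. Qed.

Lemma strong_bilinear_comb (R : realType) (k : scalar_kind)
    (E F : normedModType (scalars R k))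
    (S : {nonneg R} -> bounded_op (dual F) (dual F))
    (A B : bounded_op E (strong_space S)) (a b : scalars R k) x y :
  strong_val ((a *: A + b *: B) x) y =
  a *: (strong_val (A x) y : (scalars R k)^o) +
  b *: (strong_val (B x) y : (scalars R k)^o).
Proof. by rewrite op_linear_comb strong_val_linear_comb op_linear_comb. Qed.

(** * The weak* operator topology *)

Section wstar_operator_topology.
Context {R : realType} {k : scalar_kind}.
Local Notation K := (scalars R k).
Implicit Types E F : normedModType K.

Definition wstar_graph E F (A : bounded_op E (dual F)) : {ptws E * F -> K^o} :=
  fun xy => A xy.1 xy.2.

Lemma wstar_OT_eval E F (x : E) (y : F) :
  continuous (fun A : wstar_OT E F => (A : bounded_op E (dual F)) x y : K^o).
Proof.
move=> A; apply: (@continuous_comp (wstar_OT E F) {ptws E * F -> K^o} K^o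
  (@wstar_graph E F) (fun g => g (x, y))).
  exact: (@initial_continuous _ _ (@wstar_graph E F)).
exact: (@proj_continuous _ (fun=> K^o) (x, y)).
Qed.

(* Banach-Alaoglu: bilinearity and the bound are pointwise closed conditions,
   so pointwise limits of bounded families are again bounded operators. *)
Lemma wstar_OT_compact_closure E F (M : K) (C : set (bounded_op E (dual F))) :
  0 <= M -> (forall A, C A -> forall x y, `|A x y : K^o| <= M * `|x| * `|y|) ->
  compact (closure (C : set (wstar_OT E F))).
Proof.
move=> M0 CM; apply: initial_compact; rewrite initial_closure.
set G := (X in X @^-1` _); set D := closure _.
have ev p : continuous (fun g : {ptws E * F -> K^o} => g p).
  exact: (@proj_continuous _ (fun=> K^o) p).
have gM g : D g -> forall x y, `|g (x, y) : K^o| <= M * `|x| * `|y|.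
  move=> Dg x y.
  have := @closed_norm_le _ _ _ _ (M * `|x| * `|y|) (ev (x, y)).
  by apply => B /Dg[_ [[A CA <-] BA]]; exists (G A); split => //=; exact: CM.
(* Every limit of graphs is again a graph; hence the image under [G] of the preimage of [D] is all
   of [D], and compactness can be tested in the function space. *)
have DG : D `<=` range G.
  move=> g Dg.
  (* Identities pass to the limit: a zero set is the case of bound [0] in [closed_norm_le]. *)
  have cl0 (h : {ptws E * F -> K^o} -> K^o) : continuous h ->
      (forall A, h (G A) = 0) -> h g = 0.
    move=> hc hG; apply/eqP; rewrite -normr_le0.
    have := @closed_norm_le _ _ _ h 0 hc; apply; move=> B /Dg.
    move=> [_ [[A CA <-] BA]]; exists (G A); split => //=.
    by rewrite hG normr0.
  have lr x : linear (fun y => g (x, y) : K^o).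
    move=> a y z; apply/eqP; rewrite -subr_eq0; apply/eqP.
    apply: (cl0 (fun f : {ptws E * F -> K^o} =>
      f (x, a *: y + z) - (a *: f (x, y) + f (x, z)))).
      by apply: continuous_linear_defect; exact: ev.
    by move=> A; rewrite /G /= op_linear subrr.
  have br x : exists L : K, forall y, `|g (x, y) : K^o| <= L * `|y|.
    by exists (M * `|x|); exact: gM.
  have ll : linear (fun x => mk_op (lr x) (br x) : dual F).
    move=> a x z; apply: op_ext => y; apply/eqP; rewrite -subr_eq0; apply/eqP.
    apply: (cl0 (fun f : {ptws E * F -> K^o} =>
      f (a *: x + z, y) - (a *: f (x, y) + f (z, y)))).
      by apply: continuous_linear_defect; exact: ev.
    by move=> A; rewrite /G /= op_linear add_opE scale_opE subrr.
  have bl : exists L : K, forall x, `|mk_op (lr x) (br x) : dual F| <= L * `|x|.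
    by exists M => x; apply: op_norm_le => [|y /=]; [rewrite mulr_ge0|exact: gM].
  by exists (mk_op ll bl); last by apply/funext => -[x y].
have -> : G @` (G @^-1` D) = D.
  apply/seteqP; split=> [_ [A GA <-]//|g Dg].
  by have [A _ GA] := DG g Dg; exists A; rewrite /preimage /= GA.
(* By [gM], the closed set [D] sits in the product over [(x, y)] of the discs of radius
   [M * |x| * |y|]. *)
have cT := @tychonoff (E * F)%type (fun=> K^o) _
  (fun p => @scalar_disc_compact R k (M * `|p.1| * `|p.2|)).
apply: (subclosed_compact _ cT); first exact: closed_closure.
by move=> g Dg [x y] /=; exact: gM.
Qed.

(** The arguments pass to the limit in turn: first [A] with [B] kept in [C], then [B] with [A]
    already in the closure, the second limit being absorbed because a closure is closed. *)
Lemma wstar_OT_closure_linear_comb E F (a b : K) (C : set (bounded_op E (dual F))) :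
  (forall A B, C A -> C B -> C (a *: A + b *: B)) ->
  forall A B, closure (C : set (wstar_OT E F)) A ->
    closure (C : set (wstar_OT E F)) B ->
  closure (C : set (wstar_OT E F)) (a *: A + b *: B).
Proof.
move=> CC.
have cont (B : bounded_op E (dual F)) (a' b' : K) : continuous
    ((fun A : bounded_op E (dual F) => a' *: A + b' *: B)
       : wstar_OT E F -> wstar_OT E F).
  apply: continuous_to_initial; apply: ptws_continuous => -[x y].
  have := @continuous_affine _ _ _ _ a' (b' *: B x y : K^o)
    (wstar_OT_eval E F x y).
  set u := (X in continuous X -> _); set v := (X in _ -> continuous X).
  suff -> : u = v by [].
  by apply/funext => A; exact: (esym (bilinear_comb _ _ _ _ A B a' b' x y)).
have half A B : closure (C : set (wstar_OT E F)) A -> C B ->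
    closure (C : set (wstar_OT E F)) (a *: A + b *: B).
  move=> CA CB N /(cont B a b A) /CA[A' [CA' NA']].
  by exists (a *: A' + b *: B); split => //; exact: CC.
move=> A B CA CB; apply: closed_closure => N.
(* Swapping the summands lets [cont], which varies the first one, serve for [B]. *)
rewrite addrC => /(cont A b a B) /CB[B' [CB' NB']].
exists (b *: B' + a *: A); split => //.
by rewrite addrC; exact: half.
Qed.

End wstar_operator_topology.

(** * Convex and absolutely convex hulls *)

Lemma convex_setP (K : numFieldType) (V : lmodType K) (A : set V) :
  convex_set (A : set (convex_lmodType V)) <->
  forall l : {i01 K}, forall x y, A x -> A y -> A (l%:num *: x + (1 - l%:num) *: y).
Proof.
split=> [cA l x y Ax Ay|cA x y l /set_mem Ax /set_mem Ay].
  by have /set_mem := cA x y l (mem_set Ax) (mem_set Ay).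
exact/mem_set/(cA l).
Qed.

Lemma convex_hull_convex (K : numFieldType) (V : lmodType K) (A : set V) :
  convex_set (convex_hull A : set (convex_lmodType V)).
Proof.
apply/convex_setP => l x y Ax Ay B [cB AB].
by apply: ((convex_setP _ _ _).1 cB); [exact: Ax|exact: Ay].
Qed.

Lemma absolutely_convex_hull_absolutely_convex (K : numFieldType) (V : lmodType K)
  (A : set V) : absolutely_convex (absolutely_convex_hull A).
Proof.
split=> [|a x a1 Ax B [cB AB]]; last by apply: cB.2 => //; exact: Ax.
apply/convex_setP => l x y Ax Ay B [cB AB].
by apply: ((convex_setP _ _ _).1 cB.1); [exact: Ax|exact: Ay].
Qed.

Lemma convex_hull_sub_absolutely_convex_hull (K : numFieldType) (V : lmodType K)
  (A : set V) : convex_hull A `<=` absolutely_convex_hull A.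
Proof. by move=> x Ax B [[cB _] AB]; exact: Ax. Qed.

(** * Restricting the compactifications to the sun dual *)

Section sun_compactification.
Context {R : realType} {k : scalar_kind}.
Local Notation K := (scalars R k).
Variables (X : normedModType K) (T : c0_semigroup X).
Local Notation Xs := (sun_dual T).
Local Notation eta := (@Defs.eta R k X).
Local Notation emb := (op_comp (bidual_embedding X)).

Definition sun_graph (A : bounded_op Xs Xs) : {ptws Xs * X -> K^o} :=
  fun yx => strong_val (A yx.1) yx.2.

Definition restricted_graph (A : wstar_OT (dual X) X) : {ptws Xs * X -> K^o} :=
  fun yx => (A : bounded_op (dual X) (dual X)) (strong_val yx.1) yx.2.

Lemma restricted_graph_continuous : continuous restricted_graph.
Proof. by apply: ptws_continuous => -[y x]; exact: wstar_OT_eval. Qed.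

Lemma sun_restrictionP (V : LT_XXss T) (U : bounded_op X (dual (dual X))) :
  op_comp (sunsun_incl T) V = sun_restriction T U <->
  forall y x, strong_val (V x) y = U x (strong_val y).
Proof.
split=> [e y x|e].
  have : op_comp (sunsun_incl T) V x y = sun_restriction T U x y by rewrite e.
  by [].
by apply: op_ext => x; apply: op_ext => y; exact: e.
Qed.

Lemma absolutely_convex_hull_sub_U_0 (V : bounded_op X X) :
  absolutely_convex_hull (semigroup_set T) V -> U_0 T (emb V).
Proof. by move=> HV; apply: subset_closure; exists (emb V) => //; exists V. Qed.

Lemma compactification_subset (W W' : set (bounded_op X X)) :
  W `<=` W' -> compactification W `<=` compactification W'.
Proof.
move=> WW' U; apply: closureS => _ [_ [V WV <-] <-].
by exists (emb V) => //; exists V => //; exact: WW'.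
Qed.

Lemma eta_sun_image_subset (W W' : set (bounded_op X (dual (dual X)))) :
  W `<=` W' -> eta_sun_image T W `<=` eta_sun_image T W'.
Proof.
by move=> WW' _ [V [U WU e] <-]; exists V => //; exists U => //; exact: WW'.
Qed.

(** The substance is that no limit operator is lost: each one is [eta U] for some [U] in [U_0], and
    [U_0_LT] supplies an element of [LT_XXss] with the same pairings on the sun dual. *)
Lemma eta_sun_image_graph (W : set (bounded_op X X)) :
  bounded_semigroup T -> W `<=` absolutely_convex_hull (semigroup_set T) ->
  sun_graph @` eta_sun_image T (compactification W) =
  restricted_graph @` closure (eta @` (emb @` W) : set (wstar_OT (dual X) X)).
Proof.
move=> bT Wac; apply/seteqP; split.
  move=> _ [_ [V [U WU /sun_restrictionP e] <-] <-]; exists (eta U) => //.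
  by apply/funext => -[y x]; rewrite -[RHS]/(strong_val (V x) y) e.
(* Flipping twice is the identity, so [eta] reaches every operator on the dual. *)
move=> _ [B WB <-]; pose U := op_flip (B : bounded_op (dual X) (dual X)).
have UB : eta U = B by apply: op_ext => f; exact: op_ext.
have WU : compactification W U by rewrite /compactification /preimage /= UB.
have [V e] := U_0_LT bT (compactification_subset _ _ Wac _ WU).
exists (eta_sun V : bounded_op _ _); first by exists V => //; exists U.
move/sun_restrictionP : e => e.
by apply/funext => -[y x]; rewrite -[LHS]/(strong_val (V x) y) e.
Qed.

(** Through its graphs the set is the continuous image of a closure, and that closure is compact by
    the uniform bound inherited from the semigroup. *)
Lemma eta_sun_image_compact (W : set (bounded_op X X)) :
  bounded_semigroup T -> W `<=` absolutely_convex_hull (semigroup_set T) ->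
  compact (eta_sun_image T (compactification W) : set (kappa_sun T)).
Proof.
move=> bT Wac; apply: initial_compact.
rewrite -[X in compact X]/(sun_graph @` _) eta_sun_image_graph//.
apply: continuous_compact.
  exact/continuous_subspaceT/restricted_graph_continuous.
have [M TM] := bT; have M0 : 0 <= M by exact: le_trans (TM 0%:nng).
apply: (@wstar_OT_compact_closure _ _ _ _ M) => // _ [_ [V WV <-] <-] f x.
(* The bound on [U_0] already covers the members of [W], whose embeddings lie in [U_0]. *)
have := U_0_bounded TM (absolutely_convex_hull_sub_U_0 V (Wac V WV)) x f.
by rewrite mulrAC.
Qed.

(* B is the restriction of V^* to the sun dual. *)
Definition restricts_to (V : bounded_op X X) (B : bounded_op Xs Xs) :=
  forall y x, strong_val (B y) x = strong_val y (V x).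

(** Density rests on continuity of [restricted_graph]: a neighbourhood of the graph of [eta_sun V]
    pulls back to one of [eta U], which contains the image of some member of [W], and [D] has an
    element with the same graph. *)
Lemma eta_sun_image_sub_closure (W : set (bounded_op X X))
    (D : set (bounded_op Xs Xs)) :
  (forall V, W V -> exists2 B, D B & restricts_to V B) ->
  eta_sun_image T (compactification W) `<=` closure (D : set (kappa_sun T)).
Proof.
move=> WD _ [V [U WU /sun_restrictionP e] <-]; rewrite initial_closure.
move=> N; rewrite -[X in nbhs X]/(sun_graph (eta_sun V)).
have -> : sun_graph (eta_sun V) = restricted_graph (eta U).
  by apply/funext => -[y x]; rewrite -[LHS]/(strong_val (V x) y) e.
move=> /restricted_graph_continuous /WU [_ [[_ [V' WV' <-] <-] NV']].
have [B DB BV'] := WD _ WV'; exists (sun_graph B); split; first by exists B.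
suff -> : sun_graph B = restricted_graph (eta (emb V')) by [].
by apply/funext => -[y x]; rewrite /sun_graph BV'.
Qed.

(** * Convexity of the images and restriction of the hulls *)

Lemma compactification_linear_comb (a b : K) (W : set (bounded_op X X)) :
  (forall A B, W A -> W B -> W (a *: A + b *: B)) ->
  forall A B, compactification W A -> compactification W B ->
  compactification W (a *: A + b *: B).
Proof.
move=> cW A B WA WB.
have etaD (A' B' : bounded_op X (dual (dual X))) :
    eta (a *: A' + b *: B') = a *: eta A' + b *: eta B'.
  apply: op_ext => f; apply: op_ext => x.
  by rewrite bilinear_comb /eta !op_flipE bilinear_comb.
rewrite /compactification /preimage /= etaD.
apply: wstar_OT_closure_linear_comb => //.
move=> _ _ [_ [V WV <-] <-] [_ [V' WV' <-] <-]; rewrite -etaD.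
exists (a *: emb V + b *: emb V') => //.
exists (a *: V + b *: V'); first exact: cW.
apply: op_ext => x; rewrite add_opE !scale_opE !op_compE add_opE !scale_opE.
by rewrite opD !opZ.
Qed.

Lemma LT_XXss_val_linear_comb (a b : K) (V V' : LT_XXss T) :
  LT_XXss_val (a *: V + b *: V') = a *: LT_XXss_val V + b *: LT_XXss_val V'.
Proof. by []. Qed.

Lemma eta_sun_linear_comb (a b : K) (V V' : LT_XXss T) :
  LT_sun_val (eta_sun (a *: V + b *: V')) =
  a *: LT_sun_val (eta_sun V) + b *: LT_sun_val (eta_sun V').
Proof.
apply: op_ext => y; apply: strong_val_inj; apply: op_ext => x.
by rewrite eta_sunE LT_XXss_val_linear_comb !strong_bilinear_comb !eta_sunE.
Qed.

Lemma eta_sun_image_linear_comb (a b : K) (W : set (bounded_op X (dual (dual X)))) :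
  (forall A B, W A -> W B -> W (a *: A + b *: B)) ->
  forall A B, eta_sun_image T W A -> eta_sun_image T W B ->
  eta_sun_image T W (a *: A + b *: B).
Proof.
move=> cW _ B [V [U WU /sun_restrictionP e] <-].
case=> [V' [U' WU' /sun_restrictionP e'] <-].
exists (a *: V + b *: V'); last exact: eta_sun_linear_comb.
exists (a *: U + b *: U'); first exact: cW.
apply/sun_restrictionP => y x.
by rewrite LT_XXss_val_linear_comb strong_bilinear_comb bilinear_comb e e'.
Qed.

Lemma eta_sun_image_convex (W : set (bounded_op X X)) :
  convex_set (W : set (convex_lmodType (bounded_op X X))) ->
  convex_set (eta_sun_image T (compactification W)
    : set (convex_lmodType (bounded_op Xs Xs))).
Proof.
move=> /convex_setP cW; apply/convex_setP => l.
exact/eta_sun_image_linear_comb/compactification_linear_comb/cW.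
Qed.

Lemma eta_sun_image_absolutely_convex (W : set (bounded_op X X)) :
  absolutely_convex W -> absolutely_convex (eta_sun_image T (compactification W)).
Proof.
move=> [cW sW]; split=> [|a A a1 WA]; first exact: eta_sun_image_convex.
(* Padding with [0 *: A] brings scaling under the lemmas on two-term combinations. *)
rewrite -[a *: A]addr0 -(scale0r A).
apply: eta_sun_image_linear_comb => //; apply: compactification_linear_comb.
by move=> V V' WV _; rewrite scale0r addr0; exact: sW.
Qed.

Lemma restricts_to_linear_comb (a b : K) V V' B B' :
  restricts_to V B -> restricts_to V' B' ->
  restricts_to (a *: V + b *: V') (a *: B + b *: B').
Proof.
move=> VB VB' y x.
by rewrite strong_bilinear_comb op_linear_comb opD !opZ VB VB'.
Qed.

Lemma restricts_to_convex (D : set (bounded_op Xs Xs)) :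
  convex_set (D : set (convex_lmodType (bounded_op Xs Xs))) ->
  convex_set ([set V | exists2 B, D B & restricts_to V B]
    : set (convex_lmodType (bounded_op X X))).
Proof.
move=> /convex_setP cD; apply/convex_setP.
move=> l V V' [B DB VB] [B' DB' VB'].
exists (l%:num *: B + (1 - l%:num) *: B'); first exact: cD.
exact: restricts_to_linear_comb.
Qed.

(** Hull induction: the operators restricting into [T_sun] form a convex set, and it contains each
    [T t] because [T t] restricts to [sun_semigroup T t]. *)
Lemma convex_hull_restricts_to V :
  convex_hull (semigroup_set T) V -> exists2 B, T_sun T B & restricts_to V B.
Proof.
move=> HV; apply: (HV [set V | exists2 B, T_sun T B & restricts_to V B]).
split; first exact/restricts_to_convex/convex_hull_convex.
by move=> _ [t _ <-]; exists (sun_semigroup T t) => // D [_]; apply; exists t.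
Qed.

Lemma absolutely_convex_hull_restricts_to V :
  absolutely_convex_hull (semigroup_set T) V ->
  exists2 B, U_sun T B & restricts_to V B.
Proof.
have [cU sU] := absolutely_convex_hull_absolutely_convex _ _ (S_sun T).
move=> HV; apply: (HV [set V | exists2 B, U_sun T B & restricts_to V B]); split.
  split=> [|a W a1 [B UB WB]]; first exact: restricts_to_convex.
  exists (a *: B); first exact: sU.
  rewrite -[a *: W]addr0 -[a *: B]addr0 -(scale0r W) -(scale0r B).
  exact: restricts_to_linear_comb.
by move=> _ [t _ <-]; exists (sun_semigroup T t) => // D [_]; apply; exists t.
Qed.

(** * The isomorphism [eta_sun] and its values on the semigroup *)

Lemma eta_sun_semigroup t :
  LT_sun_val (eta_sun (LT_semigroup T t)) = sun_semigroup T t.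
Proof. by apply: op_ext => y; apply: strong_val_inj; exact: op_ext. Qed.

Lemma S_sun_sub : S_sun T `<=` S_0_sun T.
Proof.
move=> _ [t _ <-]; exists (LT_semigroup T t); last exact: eta_sun_semigroup.
exists (emb (T t)).
  by apply: subset_closure; exists (emb (T t)) => //; exists (T t) => //; exists t.
exact/sun_restrictionP.
Qed.

Lemma eta_sun_continuous :
  continuous (eta_sun (T := T) : kappa_sunsun T -> kappa_LT_sun T).
Proof.
(* [kappa_LT_sun] is initial over [kappa_sun], itself initial over pointwise convergence: hence two
   reductions. *)
do 2![apply: continuous_to_initial]; apply: ptws_continuous => -[y x].
pose f (U : LT_XXss T) : {ptws X * Xs -> K^o} := fun xy => strong_val (U xy.1) xy.2.
move=> V; apply: (@continuous_comp (kappa_sunsun T) {ptws X * Xs -> K^o} K^o f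
  (fun g => g (x, y))); first exact: (@initial_continuous _ _ f).
exact: (@proj_continuous _ (fun=> K^o) (x, y)).
Qed.

Lemma eta_sun_bijective : bijective (eta_sun (T := T)).
Proof.
have inj : injective (eta_sun (T := T)).
  move=> V V' VV'; apply: val_inj; apply: op_ext => x; apply: strong_val_inj.
  by apply: op_ext => y; rewrite -[LHS]eta_sunE VV'.
have surj A : exists V, eta_sun (T := T) V = A.
  have AP : forall phi : sunsun_dual T,
      adjoint (LT_sun_val A) (strong_val phi) \in sunsun_pred T.
    by have := LT_sun_valP A; rewrite inE.
  (* The candidate preimage is the adjoint of [A] on the embedded copy of [X]; it lands in the
     second sun dual because [A] is in [LT_sun]. *)
  pose B := op_comp (adjoint (LT_sun_val A))
    (op_comp (sunsun_incl T) (sunsun_embedding T)).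
  have BP x : B x \in sunsun_pred T by exact: AP.
  pose V := strong_corestr BP.
  (* Its sun adjoint is [A] again, so both membership conditions for [V] reduce to properties of
     [A]. *)
  have VE y : sun_adjoint V y = strong_val (LT_sun_val A y) by exact: op_ext.
  have h y : sun_adjoint V y \in sun_pred T by rewrite VE; exact: strong_valP.
  have VLT : V \in LT_XXss_pred T.
    rewrite inE; exists h => phi.
    have -> : strong_corestr h = LT_sun_val A; last exact: AP.
    by apply: op_ext => y; apply: strong_val_inj; rewrite strong_corestrE VE.
  exists (LTXXss VLT); apply: val_inj; apply: op_ext => y; apply: strong_val_inj.
  exact: op_ext.
have [g gE] := choice surj.
exists g => [V|A]; last exact: gE.
by apply: inj; rewrite gE.
Qed.

End sun_compactification.

Theorem theorem4p1 (R : realType) (k : scalar_kind)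
    (X : completeNormedModType (scalars R k)) (T : c0_semigroup X) :
  bounded_semigroup T ->
  [/\ continuous (eta_sun (T := T) : kappa_sunsun T -> kappa_LT_sun T),
      linear (eta_sun (T := T)),
      bijective (eta_sun (T := T)) &
      forall U V : LT_XXss T,
        eta_sun (LT_XXss_comp V U) = LT_sun_comp (eta_sun U) (eta_sun V)] /\
  (forall t : {nonneg R},
     LT_sun_val (eta_sun (LT_semigroup T t)) = sun_semigroup T t) /\
  [/\ [/\ S_sun T `<=` S_0_sun T,
          S_0_sun T `<=` T_0_sun T &
          T_0_sun T `<=` U_0_sun T],
      S_0_sun T `<=` closure (S_sun T : set (kappa_sun T)) /\
        compact (S_0_sun T : set (kappa_sun T)),
      [/\ T_sun T `<=` T_0_sun T,
          T_0_sun T `<=` closure (T_sun T : set (kappa_sun T)),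
          convex_set
            (T_0_sun T : set (convex_lmodType
               (bounded_op (sun_dual T) (sun_dual T)))) &
          compact (T_0_sun T : set (kappa_sun T))] &
      [/\ U_sun T `<=` U_0_sun T,
          U_0_sun T `<=` closure (U_sun T : set (kappa_sun T)),
          absolutely_convex (U_0_sun T) &
          compact (U_0_sun T : set (kappa_sun T))]].
Proof.
move=> bT.
have acS : semigroup_set T `<=` absolutely_convex_hull (semigroup_set T).
  by move=> V SV D [_]; apply.
have acT := convex_hull_sub_absolutely_convex_hull _ _ (semigroup_set T).
have hS : semigroup_set T `<=` convex_hull (semigroup_set T).
  by move=> V SV D [_]; apply.
have S0T0 : S_0_sun T `<=` T_0_sun T.
  exact/eta_sun_image_subset/compactification_subset.
have T0U0 : T_0_sun T `<=` U_0_sun T.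
  exact/eta_sun_image_subset/compactification_subset.
have cT : convex_set (T_0_sun T : set (convex_lmodType
    (bounded_op (sun_dual T) (sun_dual T)))).
  exact/eta_sun_image_convex/convex_hull_convex.
have acU : absolutely_convex (U_0_sun T).
  exact/eta_sun_image_absolutely_convex/absolutely_convex_hull_absolutely_convex.
have SS0 := S_sun_sub X T.
split; [split|split; [exact: eta_sun_semigroup|split]].
- exact: eta_sun_continuous.
- move=> a V V'; apply: val_inj.
  by have := eta_sun_linear_comb _ _ a 1 V V'; rewrite !scale1r.
- exact: eta_sun_bijective.
- move=> U V; apply: val_inj; apply: op_ext => y; apply: strong_val_inj.
  exact: op_ext.
- by split.
- split; last exact: eta_sun_image_compact.
  apply: eta_sun_image_sub_closure => _ [t _ <-].
  by exists (sun_semigroup T t) => //; exists t.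
- split=> //; last exact: eta_sun_image_compact.
    (* [T_sun] is the smallest convex set containing [S_sun], and [T_0_sun] is such a set. *)
    by move=> A; apply; split => //; exact: subset_trans S0T0.
  by apply: eta_sun_image_sub_closure; exact: convex_hull_restricts_to.
- split=> //; last exact: eta_sun_image_compact.
    move=> A; apply; split => //; apply: subset_trans T0U0.
    exact: subset_trans S0T0.
  by apply: eta_sun_image_sub_closure; exact: absolutely_convex_hull_restricts_to.
Qed.
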